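(* Let $P_1, P_2$ be closed and guarded synchronization-free ITMPC process terms (i.e., every occurrence of the parallel composition operator in them has empty synchronization set). Then \[ P_1 \sim_{\mathrm{MB,it}} P_2 \iff \Gamma_{\mathrm e}[\![P_1]\!] \sim_{\mathrm{MB,ot,e}} \Gamma_{\mathrm e}[\![P_2]\!]. \]
   Context: Notation. Let $\mathit{Name}_{\mathrm v}$ be a set of visible action names, $\tau\notin\mathit{Name}_{\mathrm v}$ the internal action, and $\mathit{Name}=\mathit{Name}_{\mathrm v}\cup\{\tau\}$. $\mathit{Relab}$ is a set of relabeling functions $\varphi:\mathit{Name}\to\mathit{Name}$ with $\varphi^{-1}(\tau)=\{\tau\}$; $\mathit{Var}$ is a set of process variables. Fix an associative and commutative binary operation $\otimes$ on $\mathbb{R}_{>0}$. ITMPC (integrated-time Markovian process calculus). Terms: $P ::= \underline{0} \mid \langle a,\lambda\rangle . P \mid P+P \mid P \parallel_S P \mid P/H \mid P[\varphi] \mid X \mid \mathrm{rec}\,X:P$ with $a\in\mathit{Name}$, $\lambda\in\mathbb{R}_{>0}$, $S,H\subseteq\mathit{Name}_{\mathrm v}$, $\varphi\in\mathit{Relab}$, $X\in\mathit{Var}$. $\mathbb{P}_{\mathrm{M,it}}$ is the set of closed and guarded terms. The transition relation $P\xrightarrow{a,\lambda}P'$ is a multiset (each transition counted with the number of its distinct derivations) generated by the rules: $\langle a,\lambda\rangle.P\xrightarrow{a,\lambda}P$; if $P_1\xrightarrow{a,\lambda}P'$ then $P_1+P_2\xrightarrow{a,\lambda}P'$ and $P_2+P_1\xrightarrow{a,\lambda}P'$;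 if $P_1\xrightarrow{a,\lambda}P_1'$ and $a\notin S$ then $P_1\parallel_S P_2\xrightarrow{a,\lambda}P_1'\parallel_S P_2$ (symmetrically for the right operand); if $P_1\xrightarrow{a,\lambda_1}P_1'$, $P_2\xrightarrow{a,\lambda_2}P_2'$, $a\in S$ then $P_1\parallel_S P_2\xrightarrow{a,\lambda_1\otimes\lambda_2}P_1'\parallel_S P_2'$; if $P\xrightarrow{a,\lambda}P'$ then $P/H\xrightarrow{\tau,\lambda}P'/H$ when $a\in H$ and $P/H\xrightarrow{a,\lambda}P'/H$ when $a\notin H$; if $P\xrightarrow{a,\lambda}P'$ then $P[\varphi]\xrightarrow{\varphi(a),\lambda}P'[\varphi]$; if $P\{\mathrm{rec}\,X:P\hookrightarrow X\}\xrightarrow{a,\lambda}P'$ then $\mathrm{rec}\,X:P\xrightarrow{a,\lambda}P'$. Define $\mathit{rate}_{\mathrm{it}}(P,a,D)=\sum\{\!|\lambda \mid \exists P'\in D.\,P\xrightarrow{a,\lambda}P'|\!\}$ (multiset sum, $0$ if empty). An equivalence relation $\mathcal B$ on $\mathbb{P}_{\mathrm{M,it}}$ is an integrated-time Markovian bisimulation if for all $(P_1,P_2)\in\mathcal B$, all $a\in\mathit{Name}$ and all $D\in\mathbb{P}_{\mathrm{M,it}}/\mathcal B$: $\mathit{rate}_{\mathrm{it}}(P_1,a,D)=\mathit{rate}_{\mathrm{it}}(P_2,a,D)$. $\sim_{\mathrm{MB,it}}$ is the union of all such bisimulations. OTMPC (orthogonal-time Markovian process calculus). Terms: $Q ::=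 \underline{0} \mid a.Q \mid (\lambda).Q \mid Q+Q \mid Q\parallel_S Q \mid Q/H \mid Q[\varphi] \mid X \mid \mathrm{rec}\,X:Q$ (same parameter ranges); $\mathbb{P}_{\mathrm{M,ot}}$ is the set of closed guarded terms. Action transitions $Q\xrightarrow{a}Q'$ form a set generated by: $a.Q\xrightarrow{a}Q$; choice rules for $+$ on both sides; interleaving of the left/right operand of $\parallel_S$ for $a\notin S$; $Q_1\parallel_S Q_2\xrightarrow{a}Q_1'\parallel_S Q_2'$ if both operands do $a$ and $a\in S$; hiding ($a\in H$ becomes $\tau$, otherwise unchanged), relabeling ($a$ becomes $\varphi(a)$), and recursion unfolding as in ITMPC. Time transitions $Q\xrightarrow{\lambda}_{\mathrm M}Q'$ form a multiset (with derivation multiplicities) generated by: $(\lambda).Q\xrightarrow{\lambda}_{\mathrm M}Q$; choice rules for $+$ on both sides; $Q_1\parallel_S Q_2$ lets either operand perform a time transition independently (no synchronization on time, for any $S$); hiding, relabeling and recursion propagate time transitions unchanged. Define $\mathit{rate}_{\mathrm{ot}}(Q,D)=\sum\{\!|\lambda\mid\exists Q'\in D.\,Q\xrightarrow{\lambda}_{\mathrm M}Q'|\!\}$. An equivalence relation $\mathcal B$ on $\mathbb{P}_{\mathrm{M,ot}}$ is an eager orthogonal-time Markovian bisimulation if for all $(Q_1,Q_2)\in\mathcal B$: for all $a\in\mathit{Name}$, whenever $Q_1\xrightarrow{a}Q_1'$ then $Q_2\xrightarrow{a}Q_2'$ with $(Q_1',Q_2')\in\mathcal B$, and vice versa; and,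 whenever neither $Q_1$ nor $Q_2$ can perform any action transition, $\mathit{rate}_{\mathrm{ot}}(Q_1,D)=\mathit{rate}_{\mathrm{ot}}(Q_2,D)$ for all $D\in\mathbb{P}_{\mathrm{M,ot}}/\mathcal B$. $\sim_{\mathrm{MB,ot,e}}$ is the union of all eager orthogonal-time Markovian bisimulations. Translation $\Gamma_{\mathrm e}$ from synchronization-free ITMPC terms to OTMPC terms, by structural induction: $\Gamma_{\mathrm e}[\![\underline 0]\!]=\underline 0$; $\Gamma_{\mathrm e}[\![\langle a,\lambda\rangle.P]\!]=(\lambda).a.\Gamma_{\mathrm e}[\![P]\!]$; $\Gamma_{\mathrm e}[\![P_1+P_2]\!]=\Gamma_{\mathrm e}[\![P_1]\!]+\Gamma_{\mathrm e}[\![P_2]\!]$; $\Gamma_{\mathrm e}[\![P_1\parallel_\emptyset P_2]\!]=\Gamma_{\mathrm e}[\![P_1]\!]\parallel_\emptyset\Gamma_{\mathrm e}[\![P_2]\!]$; $\Gamma_{\mathrm e}[\![P/H]\!]=\Gamma_{\mathrm e}[\![P]\!]/H$; $\Gamma_{\mathrm e}[\![P[\varphi]]\!]=\Gamma_{\mathrm e}[\![P]\!][\varphi]$; $\Gamma_{\mathrm e}[\![X]\!]=X$; $\Gamma_{\mathrm e}[\![\mathrm{rec}\,X:P]\!]=\mathrm{rec}\,X:\Gamma_{\mathrm e}[\![P]\!]$. *)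

(* Defs.v *)
From HB Require Import structures.
From mathcomp Require Import all_boot all_order all_algebra.
From mathcomp Require Import interval_inference.
From mathcomp Require Import boolp classical_sets functions cardinality.
From mathcomp Require Import fsbigop reals ereal esum.

Set Implicit Arguments.
Unset Strict Implicit.
Unset Printing Implicit Defensive.

Import Order.TTheory GRing.Theory Num.Theory.

Local Open Scope classical_set_scope.
Local Open Scope ring_scope.

(* [Some v] is the visible name [v], [tau] the internal action. *)
Definition name (VName : Type) : Type := option VName.
Definition tau {VName : Type} : name VName := None.

(* A set of visible names, seen as a set of names; it never contains tau. *)
Definition visible (VName : Type) (S : set VName) : set (name VName) :=
  Some @` S.

Definition hide (VName : Type) (H : set VName) (a : name VName) : name VName :=
  if a \in visible H then tau else a.

Definition relabelings (VName : Type) (Relab : set (name VName -> name VName)) :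
  Prop := forall phi, Relab phi -> phi @^-1` [set tau] = [set tau].

Section Syntax.
Variables (R : realType) (VName : Type) (Var : eqType).
Variable Relab : set (name VName -> name VName).

Inductive it_term : Type :=
| It_nil
| It_pre of name VName & {posnum R} & it_term
| It_choice of it_term & it_term
| It_par of set VName & it_term & it_term
| It_hide of it_term & set VName
| It_relab of it_term & Relab
| It_var of Var
| It_rec of Var & it_term.

Inductive ot_term : Type :=
| Ot_nil
| Ot_act of name VName & ot_term
| Ot_delay of {posnum R} & ot_term
| Ot_choice of ot_term & ot_term
| Ot_par of set VName & ot_term & ot_term
| Ot_hide of ot_term & set VName
| Ot_relab of ot_term & Relab
| Ot_var of Var
| Ot_rec of Var & ot_term.

(* Free variables, with repetitions. *)
Fixpoint it_fv (P : it_term) : seq Var :=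
  match P with
  | It_nil => [::]
  | It_pre _ _ P1 => it_fv P1
  | It_choice P1 P2 => it_fv P1 ++ it_fv P2
  | It_par _ P1 P2 => it_fv P1 ++ it_fv P2
  | It_hide P1 _ => it_fv P1
  | It_relab P1 _ => it_fv P1
  | It_var x => [:: x]
  | It_rec x P1 => [seq y <- it_fv P1 | y != x]
  end.

Fixpoint ot_fv (Q : ot_term) : seq Var :=
  match Q with
  | Ot_nil => [::]
  | Ot_act _ Q1 => ot_fv Q1
  | Ot_delay _ Q1 => ot_fv Q1
  | Ot_choice Q1 Q2 => ot_fv Q1 ++ ot_fv Q2
  | Ot_par _ Q1 Q2 => ot_fv Q1 ++ ot_fv Q2
  | Ot_hide Q1 _ => ot_fv Q1
  | Ot_relab Q1 _ => ot_fv Q1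
  | Ot_var x => [:: x]
  | Ot_rec x Q1 => [seq y <- ot_fv Q1 | y != x]
  end.

(* Free variables having an occurrence outside the scope of every prefix;
   in the orthogonal-time calculus both action and delay prefixes guard. *)
Fixpoint it_ufv (P : it_term) : seq Var :=
  match P with
  | It_nil => [::]
  | It_pre _ _ _ => [::]
  | It_choice P1 P2 => it_ufv P1 ++ it_ufv P2
  | It_par _ P1 P2 => it_ufv P1 ++ it_ufv P2
  | It_hide P1 _ => it_ufv P1
  | It_relab P1 _ => it_ufv P1
  | It_var x => [:: x]
  | It_rec x P1 => [seq y <- it_ufv P1 | y != x]
  end.

Fixpoint ot_ufv (Q : ot_term) : seq Var :=
  match Q with
  | Ot_nil => [::]
  | Ot_act _ _ => [::]
  | Ot_delay _ _ => [::]
  | Ot_choice Q1 Q2 => ot_ufv Q1 ++ ot_ufv Q2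
  | Ot_par _ Q1 Q2 => ot_ufv Q1 ++ ot_ufv Q2
  | Ot_hide Q1 _ => ot_ufv Q1
  | Ot_relab Q1 _ => ot_ufv Q1
  | Ot_var x => [:: x]
  | Ot_rec x Q1 => [seq y <- ot_ufv Q1 | y != x]
  end.

Fixpoint it_guarded (P : it_term) : bool :=
  match P with
  | It_nil => true
  | It_pre _ _ P1 => it_guarded P1
  | It_choice P1 P2 => it_guarded P1 && it_guarded P2
  | It_par _ P1 P2 => it_guarded P1 && it_guarded P2
  | It_hide P1 _ => it_guarded P1
  | It_relab P1 _ => it_guarded P1
  | It_var _ => true
  | It_rec x P1 => (x \notin it_ufv P1) && it_guarded P1
  end.

Fixpoint ot_guarded (Q : ot_term) : bool :=
  match Q with
  | Ot_nil => true
  | Ot_act _ Q1 => ot_guarded Q1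
  | Ot_delay _ Q1 => ot_guarded Q1
  | Ot_choice Q1 Q2 => ot_guarded Q1 && ot_guarded Q2
  | Ot_par _ Q1 Q2 => ot_guarded Q1 && ot_guarded Q2
  | Ot_hide Q1 _ => ot_guarded Q1
  | Ot_relab Q1 _ => ot_guarded Q1
  | Ot_var _ => true
  | Ot_rec x Q1 => (x \notin ot_ufv Q1) && ot_guarded Q1
  end.

Definition it_closed (P : it_term) : bool := nilp (it_fv P).
Definition ot_closed (Q : ot_term) : bool := nilp (ot_fv Q).

Record it_proc : Type :=
  ItProc { it_val :> it_term; itP : it_closed it_val && it_guarded it_val }.
Record ot_proc : Type :=
  OtProc { ot_val :> ot_term; otP : ot_closed ot_val && ot_guarded ot_val }.

(* [it_subst x T P] is P{T / x}. Substitution is only ever used to unfold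
   closed recursions, so [T] is closed and no capture can occur. *)
Fixpoint it_subst (x : Var) (T P : it_term) : it_term :=
  match P with
  | It_nil => It_nil
  | It_pre a l P1 => It_pre a l (it_subst x T P1)
  | It_choice P1 P2 => It_choice (it_subst x T P1) (it_subst x T P2)
  | It_par L P1 P2 => It_par L (it_subst x T P1) (it_subst x T P2)
  | It_hide P1 H => It_hide (it_subst x T P1) H
  | It_relab P1 phi => It_relab (it_subst x T P1) phi
  | It_var y => if y == x then T else It_var y
  | It_rec y P1 => if y == x then It_rec y P1 else It_rec y (it_subst x T P1)
  end.

Fixpoint ot_subst (x : Var) (T Q : ot_term) : ot_term :=
  match Q with
  | Ot_nil => Ot_nil
  | Ot_act a Q1 => Ot_act a (ot_subst x T Q1)
  | Ot_delay l Q1 => Ot_delay l (ot_subst x T Q1)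
  | Ot_choice Q1 Q2 => Ot_choice (ot_subst x T Q1) (ot_subst x T Q2)
  | Ot_par L Q1 Q2 => Ot_par L (ot_subst x T Q1) (ot_subst x T Q2)
  | Ot_hide Q1 H => Ot_hide (ot_subst x T Q1) H
  | Ot_relab Q1 phi => Ot_relab (ot_subst x T Q1) phi
  | Ot_var y => if y == x then T else Ot_var y
  | Ot_rec y Q1 => if y == x then Ot_rec y Q1 else Ot_rec y (ot_subst x T Q1)
  end.

Fixpoint sync_free (P : it_term) : Prop :=
  match P with
  | It_nil => True
  | It_pre _ _ P1 => sync_free P1
  | It_choice P1 P2 => sync_free P1 /\ sync_free P2
  | It_par L P1 P2 => [/\ L = set0, sync_free P1 & sync_free P2]
  | It_hide P1 _ => sync_free P1
  | It_relab P1 _ => sync_free P1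
  | It_var _ => True
  | It_rec _ P1 => sync_free P1
  end.

(* The translation is meaningful on synchronization-free terms, where [L] below
   is empty; its value on other terms is irrelevant. *)
Fixpoint Gamma (P : it_term) : ot_term :=
  match P with
  | It_nil => Ot_nil
  | It_pre a l P1 => Ot_delay l (Ot_act a (Gamma P1))
  | It_choice P1 P2 => Ot_choice (Gamma P1) (Gamma P2)
  | It_par L P1 P2 => Ot_par L (Gamma P1) (Gamma P2)
  | It_hide P1 H => Ot_hide (Gamma P1) H
  | It_relab P1 phi => Ot_relab (Gamma P1) phi
  | It_var x => Ot_var x
  | It_rec x P1 => Ot_rec x (Gamma P1)
  end.

Lemma Gamma_fv (P : it_term) : ot_fv (Gamma P) = it_fv P.
Proof.
by elim: P => //= [P1 -> P2 ->|S P1 -> P2 ->|x P1 ->].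
Qed.

Lemma Gamma_ufv (P : it_term) : ot_ufv (Gamma P) = it_ufv P.
Proof.
by elim: P => //= [P1 -> P2 ->|S P1 -> P2 ->|x P1 ->].
Qed.

Lemma Gamma_guarded (P : it_term) : ot_guarded (Gamma P) = it_guarded P.
Proof.
by elim: P => //= [P1 -> P2 ->|S P1 -> P2 ->|x P1 ->]; rewrite ?Gamma_ufv.
Qed.

Lemma GammaP (P : it_proc) : ot_closed (Gamma P) && ot_guarded (Gamma P).
Proof. by rewrite /ot_closed Gamma_fv Gamma_guarded itP. Qed.

Definition Gamma_proc (P : it_proc) : ot_proc := OtProc (GammaP P).

End Syntax.

Arguments It_nil {R VName Var Relab}.
Arguments It_var {R VName Var Relab} _.
Arguments Ot_nil {R VName Var Relab}.
Arguments Ot_act {R VName Var Relab} _ _.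
Arguments Ot_var {R VName Var Relab} _.

Section IntegratedTime.
Variables (R : realType) (VName : Type) (Var : eqType).
Variable Relab : set (name VName -> name VName).
Variable otimes : {posnum R} -> {posnum R} -> {posnum R}.

Local Notation term := (it_term R Var Relab).
Local Notation proc := (it_proc R Var Relab).

(* The inhabitants of [it_step P a l P'] are the distinct derivations of the
   transition, so that this family is the multiset of transitions. *)
Inductive it_step : term -> name VName -> {posnum R} -> term -> Type :=
| It_step_pre a l P :
    it_step (It_pre a l P) a l P
| It_step_choicel P1 P2 a l P' :
    it_step P1 a l P' -> it_step (It_choice P1 P2) a l P'
| It_step_choicer P1 P2 a l P' :
    it_step P2 a l P' -> it_step (It_choice P1 P2) a l P'
| It_step_parl S P1 P2 a l P1' :
    a \notin visible S -> it_step P1 a l P1' ->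
    it_step (It_par S P1 P2) a l (It_par S P1' P2)
| It_step_parr S P1 P2 a l P2' :
    a \notin visible S -> it_step P2 a l P2' ->
    it_step (It_par S P1 P2) a l (It_par S P1 P2')
| It_step_sync S P1 P2 a l1 l2 P1' P2' :
    a \in visible S -> it_step P1 a l1 P1' -> it_step P2 a l2 P2' ->
    it_step (It_par S P1 P2) a (otimes l1 l2) (It_par S P1' P2')
| It_step_hide P H a l P' :
    it_step P a l P' ->
    it_step (It_hide P H) (hide H a) l (It_hide P' H)
| It_step_relab P (phi : Relab) a l P' :
    it_step P a l P' ->
    it_step (It_relab P phi) (set_val phi a) l (It_relab P' phi)
| It_step_rec x P a l P' :
    it_step (it_subst x (It_rec x P) P) a l P' ->
    it_step (It_rec x P) a l P'.

Record it_trans (P : term) (a : name VName) : Type := ItTrans {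
  it_rate_of : {posnum R};
  it_target : term;
  it_deriv : it_step P a it_rate_of it_target }.

(* Closed guarded terms have finitely many derivations, so that the sum, taken
   in the extended reals, is then finite. *)
Definition it_rate (P : proc) (a : name VName) (D : set proc) : \bar R :=
  \esum_(t in [set t : {classic it_trans P a} |
                 (@it_val _ _ _ _ @` D) (it_target t)])
    ((it_rate_of t)%:num)%:E.

Definition it_bisimulation (B : proc -> proc -> Prop) : Prop :=
  RelationClasses.Equivalence B /\
  forall P1 P2, B P1 P2 ->
  forall (a : name VName) (D : set proc), range B D ->
    it_rate P1 a D = it_rate P2 a D.

Definition it_bisimilar (P1 P2 : proc) : Prop :=
  exists B, it_bisimulation B /\ B P1 P2.

End IntegratedTime.

Section OrthogonalTime.
Variables (R : realType) (VName : Type) (Var : eqType).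
Variable Relab : set (name VName -> name VName).

Local Notation term := (ot_term R Var Relab).
Local Notation proc := (ot_proc R Var Relab).

Inductive ot_astep : term -> name VName -> term -> Prop :=
| Ot_astep_act a Q :
    ot_astep (Ot_act a Q) a Q
| Ot_astep_choicel Q1 Q2 a Q' :
    ot_astep Q1 a Q' -> ot_astep (Ot_choice Q1 Q2) a Q'
| Ot_astep_choicer Q1 Q2 a Q' :
    ot_astep Q2 a Q' -> ot_astep (Ot_choice Q1 Q2) a Q'
| Ot_astep_parl S Q1 Q2 a Q1' :
    a \notin visible S -> ot_astep Q1 a Q1' ->
    ot_astep (Ot_par S Q1 Q2) a (Ot_par S Q1' Q2)
| Ot_astep_parr S Q1 Q2 a Q2' :
    a \notin visible S -> ot_astep Q2 a Q2' ->
    ot_astep (Ot_par S Q1 Q2) a (Ot_par S Q1 Q2')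
| Ot_astep_sync S Q1 Q2 a Q1' Q2' :
    a \in visible S -> ot_astep Q1 a Q1' -> ot_astep Q2 a Q2' ->
    ot_astep (Ot_par S Q1 Q2) a (Ot_par S Q1' Q2')
| Ot_astep_hide Q H a Q' :
    ot_astep Q a Q' -> ot_astep (Ot_hide Q H) (hide H a) (Ot_hide Q' H)
| Ot_astep_relab Q (phi : Relab) a Q' :
    ot_astep Q a Q' ->
    ot_astep (Ot_relab Q phi) (set_val phi a) (Ot_relab Q' phi)
| Ot_astep_rec x Q a Q' :
    ot_astep (ot_subst x (Ot_rec x Q) Q) a Q' -> ot_astep (Ot_rec x Q) a Q'.

(* The inhabitants of [ot_tstep Q l Q'] are the distinct derivations. *)
Inductive ot_tstep : term -> {posnum R} -> term -> Type :=
| Ot_tstep_delay l Q :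
    ot_tstep (Ot_delay l Q) l Q
| Ot_tstep_choicel Q1 Q2 l Q' :
    ot_tstep Q1 l Q' -> ot_tstep (Ot_choice Q1 Q2) l Q'
| Ot_tstep_choicer Q1 Q2 l Q' :
    ot_tstep Q2 l Q' -> ot_tstep (Ot_choice Q1 Q2) l Q'
| Ot_tstep_parl S Q1 Q2 l Q1' :
    ot_tstep Q1 l Q1' -> ot_tstep (Ot_par S Q1 Q2) l (Ot_par S Q1' Q2)
| Ot_tstep_parr S Q1 Q2 l Q2' :
    ot_tstep Q2 l Q2' -> ot_tstep (Ot_par S Q1 Q2) l (Ot_par S Q1 Q2')
| Ot_tstep_hide Q H l Q' :
    ot_tstep Q l Q' -> ot_tstep (Ot_hide Q H) l (Ot_hide Q' H)
| Ot_tstep_relab Q (phi : Relab) l Q' :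
    ot_tstep Q l Q' -> ot_tstep (Ot_relab Q phi) l (Ot_relab Q' phi)
| Ot_tstep_rec x Q l Q' :
    ot_tstep (ot_subst x (Ot_rec x Q) Q) l Q' -> ot_tstep (Ot_rec x Q) l Q'.

Record ot_trans (Q : term) : Type := OtTrans {
  ot_rate_of : {posnum R};
  ot_target : term;
  ot_deriv : ot_tstep Q ot_rate_of ot_target }.

Definition ot_rate (Q : proc) (D : set proc) : \bar R :=
  \esum_(t in [set t : {classic ot_trans Q} |
                 (@ot_val _ _ _ _ @` D) (ot_target t)])
    ((ot_rate_of t)%:num)%:E.

Definition ot_no_action (Q : term) : Prop :=
  forall a Q', ~ ot_astep Q a Q'.

Definition ot_bisimulation (B : proc -> proc -> Prop) : Prop :=
  RelationClasses.Equivalence B /\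
  forall Q1 Q2, B Q1 Q2 ->
  [/\ forall (a : name VName) (Q1' : proc), ot_astep Q1 a Q1' ->
        exists2 Q2' : proc, ot_astep Q2 a Q2' & B Q1' Q2',
      forall (a : name VName) (Q2' : proc), ot_astep Q2 a Q2' ->
        exists2 Q1' : proc, ot_astep Q1 a Q1' & B Q1' Q2'
    & ot_no_action Q1 -> ot_no_action Q2 ->
        forall D : set proc, range B D -> ot_rate Q1 D = ot_rate Q2 D].

Definition ot_bisimilar (Q1 Q2 : proc) : Prop :=
  exists B, ot_bisimulation B /\ B Q1 Q2.

End OrthogonalTime.

(* Main.v *)
(* Let [P] be synchronization-free.  No action is enabled in [Gamma P], and
   each delay of [Gamma P] comes from exactly one transition [P -a,l-> P'],
   leading after the same rate [l] to a state whose only enabled action is [a],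
   with target [Gamma P'].  A bisimulation of ITMPC therefore lifts to OTMPC by
   identifying such states when they agree on [a] and on the class of [P'].
   Conversely, a bisimulation of OTMPC restricts along [Gamma]; it may separate
   states with the same [a] and the same class of [P'], so that the
   integrated-time rate into a class is the sum of the orthogonal-time rates
   into several classes. *)
Require Import Defs.
From HB Require Import structures.
From mathcomp Require Import all_boot all_order all_algebra.
From mathcomp Require Import interval_inference boolp classical_sets reals.
From mathcomp Require Import functions ereal esum.

Local Open Scope classical_set_scope.
Local Open Scope ring_scope.

Set Implicit Arguments.
Unset Strict Implicit.
Unset Printing Implicit Defensive.

(** * Closed and guarded terms are preserved by unfolding and by transitions *)

Section WellFormed.
Variables (R : realType) (VName : Type) (Var : eqType).
Variable Relab : set (name VName -> name VName).
Local Notation term := (ot_term R Var Relab).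
Implicit Types (P Q T : term) (x : Var).

Lemma ot_ufv_sub_fv Q : {subset ot_ufv Q <= ot_fv Q}.
Proof.
elim: Q => [|a Q I|l Q I|Q1 I1 Q2 I2|S Q1 I1 Q2 I2|Q I H|Q I phi|x|x Q I] y //=.
- by rewrite !mem_cat => /orP[/I1|/I2] ->; rewrite ?orbT.
- by rewrite !mem_cat => /orP[/I1|/I2] ->; rewrite ?orbT.
- exact: I.
- exact: I.
- by rewrite !mem_filter => /andP[-> /I].
Qed.

Lemma ot_closed_ufv T : ot_closed T -> ot_ufv T = [::].
Proof.
move=> /nilP cT; case E: (ot_ufv T) => [//|y s].
by have := @ot_ufv_sub_fv T y; rewrite E cT mem_head => /(_ isT).
Qed.

Lemma ot_fv_subst x T Q : ot_closed T ->
  ot_fv (ot_subst x T Q) = [seq y <- ot_fv Q | y != x].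
Proof.
move=> /nilP cT; elim: Q => //= [Q1 -> Q2 ->|S Q1 -> Q2 ->|y|y Q IQ].
- by rewrite filter_cat.
- by rewrite filter_cat.
- by case: eqP.
- case: eqP => [->|_] /=; first by rewrite filter_id.
  by rewrite IQ -!filter_predI; apply: eq_filter => z /=; rewrite andbC.
Qed.

Lemma ot_ufv_subst x T Q : ot_closed T ->
  ot_ufv (ot_subst x T Q) = [seq y <- ot_ufv Q | y != x].
Proof.
move=> /ot_closed_ufv cT; elim: Q => //= [Q1 -> Q2 ->|S Q1 -> Q2 ->|y|y Q IQ].
- by rewrite filter_cat.
- by rewrite filter_cat.
- by case: eqP.
- case: eqP => [->|_] /=; first by rewrite filter_id.
  by rewrite IQ -!filter_predI; apply: eq_filter => z /=; rewrite andbC.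
Qed.

Lemma ot_guarded_subst x T Q : ot_closed T -> ot_guarded T ->
  ot_guarded Q -> ot_guarded (ot_subst x T Q).
Proof.
move=> cT gT; elim: Q => //= [Q1 I1 Q2 I2|S Q1 I1 Q2 I2|y|y Q I].
- by move=> /andP[/I1-> /I2->].
- by move=> /andP[/I1-> /I2->].
- by case: eqP.
(* Since [T] is closed, the substitution brings in no unguarded variable, so the bound [y] stays
   guarded. *)
- case: eqP => //= _ /andP[yQ /I->]; rewrite andbT ot_ufv_subst//.
  by rewrite mem_filter negb_and yQ orbT.
Qed.

Definition ot_wf Q := ot_closed Q && ot_guarded Q.

Lemma ot_wf_choice Q1 Q2 : ot_wf (Ot_choice Q1 Q2) = ot_wf Q1 && ot_wf Q2.
Proof. by rewrite /ot_wf /ot_closed /= cat_nilp andbACA. Qed.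

Lemma ot_wf_par S Q1 Q2 : ot_wf (Ot_par S Q1 Q2) = ot_wf Q1 && ot_wf Q2.
Proof. exact: ot_wf_choice. Qed.

Lemma ot_wf_unfold x Q :
  ot_wf (Ot_rec x Q) -> ot_wf (ot_subst x (Ot_rec x Q) Q).
Proof.
move=> /[dup] /andP[cQ gQ] /andP[/= _ /andP[_ gQ1]].
by rewrite /ot_wf ot_guarded_subst// andbT /ot_closed ot_fv_subst.
Qed.

(** Transitions relate bare terms; together with [ot_tstep_wf], this turns their targets into
    elements of [ot_proc]. *)
Lemma ot_astep_wf Q a Q' : ot_astep Q a Q' -> ot_wf Q -> ot_wf Q'.
Proof.
elim=> // {Q a Q'}.
- by move=> Q1 Q2 a Q' _ I; rewrite ot_wf_choice => /andP[/I].
- by move=> Q1 Q2 a Q' _ I; rewrite ot_wf_choice => /andP[_ /I].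
- by move=> S Q1 Q2 a Q' _ _ I; rewrite !ot_wf_par => /andP[/I->].
- by move=> S Q1 Q2 a Q' _ _ I; rewrite !ot_wf_par => /andP[-> /I].
- move=> S Q1 Q2 a Q1' Q2' _ _ I1 _ I2.
  by rewrite !ot_wf_par => /andP[/I1-> /I2].
- by move=> x Q a Q' _ I /ot_wf_unfold.
Qed.

Lemma ot_tstep_wf Q l Q' : ot_tstep Q l Q' -> ot_wf Q -> ot_wf Q'.
Proof.
elim=> // {Q l Q'}.
- by move=> Q1 Q2 l Q' _ I; rewrite ot_wf_choice => /andP[/I].
- by move=> Q1 Q2 l Q' _ I; rewrite ot_wf_choice => /andP[_ /I].
- by move=> S Q1 Q2 l Q' _ I; rewrite !ot_wf_par => /andP[/I->].
- by move=> S Q1 Q2 l Q' _ I; rewrite !ot_wf_par => /andP[-> /I].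
- by move=> x Q l Q' _ I /ot_wf_unfold.
Qed.

End WellFormed.

Section Translation.
Variables (R : realType) (VName : Type) (Var : eqType).
Variable Relab : set (name VName -> name VName).
Variable otimes : {posnum R} -> {posnum R} -> {posnum R}.
Local Notation iterm := (it_term R Var Relab).
Local Notation oterm := (ot_term R Var Relab).
Local Notation iproc := (it_proc R Var Relab).
Local Notation oproc := (ot_proc R Var Relab).

(** * Injectivity of the translation, substitution, synchronization-freeness *)

Lemma it_val_inj : injective (@it_val R VName Var Relab).
Proof.
by move=> [P p] [P' p'] /= e; subst P'; rewrite (bool_irrelevance p p').
Qed.

Lemma ot_val_inj : injective (@ot_val R VName Var Relab).
Proof.
by move=> [P p] [P' p'] /= e; subst P'; rewrite (bool_irrelevance p p').
Qed.

Lemma Gamma_inj : injective (@Gamma R VName Var Relab).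
Proof.
elim=> [|a l P I|P1 I1 P2 I2|S P1 I1 P2 I2|P I H|P I phi|x|x P I];
  case=> [|a' l' P'|P1' P2'|S' P1' P2'|P' H'|P' phi'|x'|x' P'] //= -[].
- by move=> -> -> /I->.
- by move=> /I1-> /I2->.
- by move=> -> /I1-> /I2->.
- by move=> /I-> ->.
- by move=> /I-> ->.
- by move=> ->.
- by move=> -> /I->.
Qed.

Lemma Gamma_subst x (T P : iterm) :
  Gamma (it_subst x T P) = ot_subst x (Gamma T) (Gamma P).
Proof.
elim: P => //= [a l P ->|P1 -> P2 ->|S P1 -> P2 ->|P -> H|P -> phi|y|y P I] //.
- by case: eqP.
- by case: eqP => //= _; rewrite I.
Qed.

Lemma sync_free_subst x (T P : iterm) :
  sync_free T -> sync_free P -> sync_free (it_subst x T P).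
Proof.
move=> sT; elim: P => //= [P1 I1 P2 I2|S P1 I1 P2 I2|y _|y P I].
- by case=> /I1 ? /I2.
- by case=> ? /I1 ? /I2.
- by case: eqP.
- by case: eqP => //= _ /I.
Qed.

Lemma sync_free_unfold x (P : iterm) :
  sync_free P -> sync_free (it_subst x (It_rec x P) P).
Proof. by move=> sP; apply: sync_free_subst. Qed.

Lemma notin_visible0 (S : set VName) a : S = set0 -> a \notin visible S.
Proof. by move=> ->; rewrite /visible image_set0 in_set0. Qed.

Lemma sync_free_no_sync S (P1 P2 : iterm) a :
  a \in visible S -> ~ sync_free (It_par S P1 P2).
Proof. by move=> aS [/(notin_visible0 a)]; rewrite aS. Qed.

Lemma it_step_sync_free (P : iterm) a l P' :
  it_step otimes P a l P' -> sync_free P -> sync_free P'.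
Proof.
elim=> //= {P a l P'}.
- by move=> P1 P2 a l P' _ I [/I].
- by move=> P1 P2 a l P' _ I [_ /I].
- by move=> S P1 P2 a l P' _ _ I [? /I].
- by move=> S P1 P2 a l P' _ _ I [? ? /I].
- by move=> S P1 P2 a l1 l2 P1' P2' _ _ I1 _ I2 [? /I1 ? /I2].
- by move=> x P a l P' _ I /(sync_free_unfold x)/I.
Qed.

(** Every action prefix produced by [Gamma] sits directly under a delay, and unfolding commutes with
    [Gamma], so a derivation of an action has no possible leaf. *)
Lemma Gamma_no_action (P : iterm) : ot_no_action (Gamma P).
Proof.
move=> a Q'; move E: (Gamma P) => Q s; elim: s P E => {Q a Q'}.
- by move=> a Q; case.
- by move=> Q1 Q2 a Q' _ I; case=> //= P1 P2 [/I].
- by move=> Q1 Q2 a Q' _ I; case=> //= P1 P2 [_ /I].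
- by move=> S Q1 Q2 a Q' _ _ I; case=> //= L P1 P2 [_ /I].
- by move=> S Q1 Q2 a Q' _ _ I; case=> //= L P1 P2 [_ _ /I].
- by move=> S Q1 Q2 a Q' Q2' _ _ I _ _; case=> //= L P1 P2 [_ /I].
- by move=> Q H a Q' _ I; case=> //= P H' [/I].
- by move=> Q phi a Q' _ I; case=> //= P phi' [/I].
- move=> x Q a Q' _ I; case=> //= y P [e E]; subst y.
  by apply: (I (it_subst x (It_rec x P) P)); rewrite Gamma_subst -E.
Qed.

(** * Bijection between the transitions of [P] and the delays of [Gamma P] *)

Definition pending (Q : oterm) (b : name VName) (Q1 : oterm) : Prop :=
  forall a Q', ot_astep Q a Q' <-> a = b /\ Q' = Q1.

(** The source is a variable [Q] with an equation because the unfolding of a translation is only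
    propositionally the translation of the unfolding. Case analysis on [Q] then avoids transports,
    and the round trips below compute. *)
Definition Gamma_step (P : iterm) a l P' (d : it_step otimes P a l P') :
  forall Q, Q = Gamma P -> sync_free P -> ot_trans Q.
Proof.
elim: d => {P a l P'}
  [a l P|P1 P2 a l P' _ I|P1 P2 a l P' _ I|S P1 P2 a l P' _ _ I
  |S P1 P2 a l P' _ _ I|S P1 P2 a l1 l2 P1' P2' aS _ _ _ _
  |P H a l P' _ I|P phi a l P' _ I|x P a l P' _ I].
- case=> // l' Q _ _; exact: (OtTrans (Ot_tstep_delay l' Q)).
- case=> // Q1 Q2 E sP.
  refine (OtTrans (Ot_tstep_choicel Q2 (ot_deriv (I Q1 _ _)))).
    by case: E.
  by case: sP.
- case=> // Q1 Q2 E sP.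
  refine (OtTrans (Ot_tstep_choicer Q1 (ot_deriv (I Q2 _ _)))).
    by case: E.
  by case: sP.
- case=> // L Q1 Q2 E sP.
  refine (OtTrans (Ot_tstep_parl L Q2 (ot_deriv (I Q1 _ _)))).
    by case: E.
  by case: sP.
- case=> // L Q1 Q2 E sP.
  refine (OtTrans (Ot_tstep_parr L Q1 (ot_deriv (I Q2 _ _)))).
    by case: E.
  by case: sP.
- by move=> Q _ /(sync_free_no_sync aS).
- case=> // Q H' E sP.
  refine (OtTrans (Ot_tstep_hide H' (ot_deriv (I Q _ sP)))).
  by case: E.
- case=> // Q phi' E sP.
  refine (OtTrans (Ot_tstep_relab phi' (ot_deriv (I Q _ sP)))).
  by case: E.
- case=> // y Q E sP.
  refine (OtTrans (Ot_tstep_rec (ot_deriv (I _ _ _)))).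
    by case: E => -> ->; rewrite Gamma_subst.
  exact: sync_free_unfold.
Defined.

(** The action belongs to the result, since a delay does not display it: it is recovered from the
    prefix of [P] that the delay comes from, up to hiding and relabeling. *)
Definition Gamma_unstep (Q : oterm) l Q' (d : ot_tstep Q l Q') :
  forall P, Q = Gamma P -> sync_free P -> {a & it_trans otimes P a}.
Proof.
elim: d => {Q l Q'}
  [l Q|Q1 Q2 l Q' _ I|Q1 Q2 l Q' _ I|S Q1 Q2 l Q' _ I
  |S Q1 Q2 l Q' _ I|Q H l Q' _ I|Q phi l Q' _ I|x Q l Q' _ I].
- case=> // a l' P _ _.
  exact: (existT _ a (ItTrans (It_step_pre otimes a l' P))).
- case=> // P1 P2 E sP.
  refine (existT _ _
    (ItTrans (It_step_choicel P2 (it_deriv (projT2 (I P1 _ _)))))).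
    by case: E.
  by case: sP.
- case=> // P1 P2 E sP.
  refine (existT _ _
    (ItTrans (It_step_choicer P1 (it_deriv (projT2 (I P2 _ _)))))).
    by case: E.
  by case: sP.
- case=> // L P1 P2 E sP.
  refine (existT _ _
    (ItTrans (It_step_parl P2 (notin_visible0 _ _)
      (it_deriv (projT2 (I P1 _ _)))))).
  + by case: sP.
  + by case: E.
  + by case: sP.
- case=> // L P1 P2 E sP.
  refine (existT _ _
    (ItTrans (It_step_parr P1 (notin_visible0 _ _)
      (it_deriv (projT2 (I P2 _ _)))))).
  + by case: sP.
  + by case: E.
  + by case: sP.
- case=> // P H' E sP.
  refine (existT _ _
    (ItTrans (It_step_hide H' (it_deriv (projT2 (I P _ sP)))))).
  by case: E.
- case=> // P phi' E sP.
  refine (existT _ _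
    (ItTrans (It_step_relab phi' (it_deriv (projT2 (I P _ sP)))))).
  by case: E.
- case=> // y P E sP.
  refine (existT _ _ (ItTrans (It_step_rec (it_deriv (projT2 (I _ _ _)))))).
    by case: E => -> ->; rewrite Gamma_subst.
  exact: sync_free_unfold.
Defined.

Lemma Gamma_stepK (P : iterm) a l P' (d : it_step otimes P a l P')
    Q (E E' : Q = Gamma P) (sP sP' : sync_free P) :
  Gamma_unstep (ot_deriv (Gamma_step d E sP)) E' sP' = existT _ a (ItTrans d).
Proof.
elim: d Q E E' sP sP' => {P a l P'}
  [a l P|P1 P2 a l P' d I|P1 P2 a l P' d I|S P1 P2 a l P' aS d I
  |S P1 P2 a l P' aS d I|S P1 P2 a l1 l2 P1' P2' aS d1 I1 d2 I2
  |P H a l P' d I|P phi a l P' d I|x P a l P' d I].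
- by case.
- by case=> // Q1 Q2 E E' sP sP' /=;  rewrite I.
- by case=> // Q1 Q2 E E' sP sP' /=; rewrite I.
- case=> // L Q1 Q2 E E' sP sP' /=; rewrite I/=.
  (* The two derivations differ only in their proofs of the boolean side condition
     [a \notin visible S]. *)
  by congr (existT _ _ (ItTrans (It_step_parl _ _ _))); exact: bool_irrelevance.
- case=> // L Q1 Q2 E E' sP sP' /=; rewrite I/=.
  by congr (existT _ _ (ItTrans (It_step_parr _ _ _))); exact: bool_irrelevance.
- by move=> Q E E' sP; case: (sync_free_no_sync aS sP).
- by case=> // Q L E E' sP sP' /=; rewrite I.
- by case=> // Q L E E' sP sP' /=; rewrite I.
- by case=> // y Q E E' sP sP' /=; rewrite I.
Qed.

Lemma Gamma_unstepK (Q : oterm) l Q' (d : ot_tstep Q l Q')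
    P (E E' : Q = Gamma P) (sP sP' : sync_free P) :
  Gamma_step (it_deriv (projT2 (Gamma_unstep d E sP))) E' sP' = OtTrans d.
Proof.
elim: d P E E' sP sP' => {Q l Q'}
  [l Q|Q1 Q2 l Q' d I|Q1 Q2 l Q' d I|S Q1 Q2 l Q' d I
  |S Q1 Q2 l Q' d I|Q H l Q' d I|Q phi l Q' d I|x Q l Q' d I].
- by case.
- by case=> // P1 P2 E E' sP sP' /=; rewrite I.
- by case=> // P1 P2 E E' sP sP' /=; rewrite I.
- by case=> // L P1 P2 E E' sP sP' /=; rewrite I.
- by case=> // L P1 P2 E E' sP sP' /=; rewrite I.
- by case=> // P L E E' sP sP' /=; rewrite I.
- by case=> // P L E E' sP sP' /=; rewrite I.
- by case=> // y P E E' sP sP' /=; rewrite I.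
Qed.

Lemma Gamma_step_rate (P : iterm) a l P' (d : it_step otimes P a l P')
    Q (E : Q = Gamma P) (sP : sync_free P) :
  ot_rate_of (Gamma_step d E sP) = l.
Proof.
elim: d Q E sP => {P a l P'}
  [a l P|P1 P2 a l P' d I|P1 P2 a l P' d I|S P1 P2 a l P' aS d I
  |S P1 P2 a l P' aS d I|S P1 P2 a l1 l2 P1' P2' aS d1 I1 d2 I2
  |P H a l P' d I|P phi a l P' d I|x P a l P' d I]; case=> //=.
- by move=> l' Q [].
- by move=> L Q1 Q2 E sP; case: (sync_free_no_sync aS sP).
Qed.

(** * The pending action after a delay, and the comparison of rates *)

Lemma ot_astep_par0 (Q1 Q2 : oterm) a Q' :
  ot_astep (Ot_par set0 Q1 Q2) a Q' ->
  (exists2 Q1', ot_astep Q1 a Q1' & Q' = Ot_par set0 Q1' Q2) \/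
  (exists2 Q2', ot_astep Q2 a Q2' & Q' = Ot_par set0 Q1 Q2').
Proof.
move E: (Ot_par _ _ _) => Q s; case: s E => // {Q a Q'}.
- by move=> S ? ? a Q1' _ s [-> -> ->]; left; exists Q1'.
- by move=> S ? ? a Q2' _ s [-> -> ->]; right; exists Q2'.
- by move=> S ? ? a ? ? aS _ _ [/esym/(notin_visible0 a)]; rewrite aS.
Qed.

Lemma pending_parl (Q1 Q2 Q1' : oterm) b :
  pending Q1 b Q1' -> ot_no_action Q2 ->
  pending (Ot_par set0 Q1 Q2) b (Ot_par set0 Q1' Q2).
Proof.
move=> p1 n2 a Q'; split=> [/ot_astep_par0[[Q /p1[-> ->]]|[Q /n2]]//|[-> ->]].
by apply: Ot_astep_parl; [exact: notin_visible0|exact/p1].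
Qed.

Lemma pending_parr (Q1 Q2 Q2' : oterm) b :
  pending Q2 b Q2' -> ot_no_action Q1 ->
  pending (Ot_par set0 Q1 Q2) b (Ot_par set0 Q1 Q2').
Proof.
move=> p2 n1 a Q'; split=> [/ot_astep_par0[[Q /n1]|[Q /p2[-> ->]]]//|[-> ->]].
by apply: Ot_astep_parr; [exact: notin_visible0|exact/p2].
Qed.

Lemma pending_hide (Q Q1 : oterm) H b :
  pending Q b Q1 -> pending (Ot_hide Q H) (Defs.hide H b) (Ot_hide Q1 H).
Proof.
move=> p a Q'; split=> [|[-> ->]]; last by apply/Ot_astep_hide/p.
move E: (Ot_hide Q H) => T s; case: s E => // {T a Q'} T L a Q' s [E ->].
by move: s; rewrite -E => /p[-> ->].
Qed.

Lemma pending_relab (Q Q1 : oterm) (phi : Relab) b :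
  pending Q b Q1 -> pending (Ot_relab Q phi) (set_val phi b) (Ot_relab Q1 phi).
Proof.
move=> p a Q'; split=> [|[-> ->]]; last by apply/Ot_astep_relab/p.
move E: (Ot_relab Q phi) => T s; case: s E => // {T a Q'} T psi a Q' s [E ->].
by move: s; rewrite -E => /p[-> ->].
Qed.

(** Only the operand that performed the delay exposes an action; its parallel neighbours are still
    translations and have none. Hiding and relabeling rename this action exactly as they rename the
    label of the integrated-time transition. *)
Lemma Gamma_step_pending (P : iterm) a l P' (d : it_step otimes P a l P')
    Q (E : Q = Gamma P) (sP : sync_free P) :
  pending (ot_target (Gamma_step d E sP)) a (Gamma P').
Proof.
elim: d Q E sP => {P a l P'}
  [a l P|P1 P2 a l P' d I|P1 P2 a l P' d I|S P1 P2 a l P' aS d I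
  |S P1 P2 a l P' aS d I|S P1 P2 a l1 l2 P1' P2' aS d1 I1 d2 I2
  |P H a l P' d I|P phi a l P' d I|x P a l P' d I]; case=> //=.
- move=> l' Q [_ ->] _ b Q'; split=> [|[-> ->]]; last exact: Ot_astep_act.
  move E: (Ot_act a _) => T s; by case: s E => // ? ? [-> ->].
- move=> L Q1 Q2 E sP.
  have [L0 S0 Q0] : [/\ L = set0, S = set0 & Q2 = Gamma P2].
    by case: (sP) (E) => S0 _ _ [-> _ ->]; rewrite S0.
  by subst; apply: pending_parl (I _ _ _) _; exact: Gamma_no_action.
- move=> L Q1 Q2 E sP.
  have [L0 S0 Q0] : [/\ L = set0, S = set0 & Q1 = Gamma P1].
    by case: (sP) (E) => S0 _ _ [-> -> _]; rewrite S0.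
  by subst; apply: pending_parr (I _ _ _) _; exact: Gamma_no_action.
- by move=> L Q1 Q2 E sP; case: (sync_free_no_sync aS sP).
- move=> Q L E sP; have LH : L = H by case: E.
  by subst L; apply: pending_hide.
- move=> Q psi E sP; have LH : psi = phi by case: E.
  by subst psi; apply: pending_relab.
Qed.

(** All delays of [Gamma P] lead to pending states, on which the hypothesis decides membership in
    [E]. Hence [Gamma_step] restricts to a rate-preserving bijection from the [a]-transitions into
    [C] to the delays into [E]. *)
Lemma ot_rate_Gamma (P : iproc) a (C : set iproc) (E : set oproc) :
  sync_free P ->
  (forall (Q : oproc) (P1 : iproc) b, sync_free P1 -> pending Q b (Gamma P1) ->
    E Q <-> b = a /\ C P1) ->
  ot_rate (Gamma_proc P) E = it_rate otimes P a C.
Proof.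
move=> sP EC.
have step_wf b l P1 (d : it_step otimes P b l P1) :
    exists (Q : oproc) (P1' : iproc),
      [/\ ot_target (Gamma_step d erefl sP) = Q, P1 = P1', sync_free P1 &
        pending Q b (Gamma P1)].
  have pd := Gamma_step_pending d erefl sP.
  have wQ := ot_tstep_wf (ot_deriv (Gamma_step d erefl sP)) (GammaP P).
  (* [P1] is closed and guarded because [Gamma P1], reached by the pending action, is, and [Gamma]
     preserves free variables and guardedness. *)
  have := ot_astep_wf (proj2 (pd b (Gamma P1)) (conj erefl erefl)) wQ.
  rewrite /ot_wf /ot_closed Gamma_fv Gamma_guarded => wP1.
  exists (OtProc wQ), (ItProc wP1); split; rewrite //.
  exact: it_step_sync_free d sP.
have stepE b l P1 (d : it_step otimes P b l P1) :
    (@ot_val _ _ _ _ @` E) (ot_target (Gamma_step d erefl sP)) <->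
    b = a /\ (@it_val _ _ _ _ @` C) P1.
  have [Q [P1' [-> P1E sP1 pd]]] := step_wf _ _ _ d; subst P1.
  have EQ := EC _ _ _ sP1 pd; split=> [[Q1 + /ot_val_inj Q1E]|].
    by rewrite Q1E => /EQ[-> CP]; split=> //; exists P1'.
  move=> [ba [P2 CP /it_val_inj P2E]]; exists Q => //; apply/EQ.
  by rewrite -P2E.
rewrite /ot_rate /it_rate.
pose e (t : {classic it_trans otimes P a}) :
    {classic ot_trans (Gamma_proc P)} :=
  Gamma_step (it_deriv t) erefl sP.
pose A := [set t : {classic it_trans otimes P a} |
  (@it_val _ _ _ _ @` C) (it_target t)].
pose B := [set t : {classic ot_trans (Gamma_proc P)} |
  (@ot_val _ _ _ _ @` E) (ot_target t)].
suff eAB : set_bij A B e.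
  rewrite (@reindex_esum _ _ _ A B e)//.
  by apply: eq_esum => t _; rewrite Gamma_step_rate.
split.
- by move=> t Ct; apply/stepE.
- move=> t1 t2 _ _ e12.
  have := Gamma_stepK (it_deriv t1) erefl erefl sP sP.
  rewrite -/(e t1) e12 (Gamma_stepK (it_deriv t2) erefl erefl sP sP).
  case: t1 t2 {e12} => [l1 P1 d1] [l2 P2 d2] E12.
  have := projT2_eq E12.
  by rewrite (Prop_irrelevance (projT1_eq E12) erefl) /=.
- move=> [l Q d] /= Et.
  have K := Gamma_unstepK d erefl erefl sP sP.
  move: K; case: (Gamma_unstep _ _ _) => b t K.
  (* A priori the preimage [t] has any label [b]; its image ending in [E] forces [b = a]. *)
  have := stepE _ _ _ (it_deriv t); rewrite K /= => -[/(_ Et)[ba Ct] _].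
  by move: t K Ct; rewrite ba => t K Ct; exists t.
Qed.

Lemma it_rate_set0 (P : iproc) a : it_rate otimes P a set0 = 0%E.
Proof. by apply: esum1 => t [? []]. Qed.

(** By disjointness, each transition into the union enters exactly one member of [K], so the second
    projection reindexes the sum over pairs. *)
Lemma ot_rate_bigcup (Q : oproc) (K : set (set oproc)) :
  trivIset K id ->
  ot_rate Q (\bigcup_(D in K) D) =
  \esum_(D in (K : set {classic set oproc})) ot_rate Q D.
Proof.
move=> tK; pose J (D : {classic set oproc}) : set {classic ot_trans Q} :=
  [set t | (@ot_val _ _ _ _ @` D) (ot_target t)].
rewrite /ot_rate [RHS](@esum_esum _ _ _ _ J)//.
apply: (@reindex_esum _ _ _ _ _ snd); split.
- by move=> [D t] /= [KD [T DT Tt]]; exists T => //; exists D.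
- move=> [D t] [D' t'] /= /set_mem[/= KD [T DT Tt]].
  move=> /set_mem[/= KD' [T' DT' T't']] tt'; congr pair => //.
  apply: tK => //; exists T; split=> //=.
  by rewrite (_ : T = T')//; apply: ot_val_inj; rewrite Tt T't' tt'.
- by move=> t [T [D KD DT] Tt]; exists (D, t) => //; split=> //; exists T.
Qed.

(** * Lifting an integrated-time bisimulation *)

Lemma pending_inj (Q Q1 Q2 : oterm) b1 b2 :
  pending Q b1 Q1 -> pending Q b2 Q2 -> b1 = b2 /\ Q1 = Q2.
Proof. by move=> p1 p2; apply/p2/p1. Qed.

Lemma pending_action (Q Q1 : oterm) b : pending Q b Q1 -> ot_astep Q b Q1.
Proof. by move=> p; apply/p. Qed.

Lemma pending_Gamma (P : iterm) b Q1 : ~ pending (Gamma P) b Q1.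
Proof. by move=> /pending_action/Gamma_no_action. Qed.

(* The [B]-class of processes that [Q] translates, tagged with [None], or that
   [Q] reaches by its only, pending, action, tagged with that action. *)
Definition source (B : iproc -> iproc -> Prop) (Q : oproc) :
    set (option (name VName) * iproc) :=
  [set u | exists P : iproc, [/\ sync_free P, B P u.2 &
    if u.1 is Some b then pending Q b (Gamma P) else Q = Gamma P :> oterm]].

(** The second clause keeps the states with empty source, which have nothing to do with
    translations, from being identified with one another. *)
Definition ot_lift (B : iproc -> iproc -> Prop) (Q1 Q2 : oproc) : Prop :=
  source B Q1 = source B Q2 /\ (source B Q1 = set0 -> Q1 = Q2).

Lemma ot_lift_equiv B : RelationClasses.Equivalence (ot_lift B).
Proof.
split=> [Q|Q1 Q2 [s12 e12]|Q1 Q2 Q3 [s12 e12] [s23 e23]]; first by split.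
  by split=> [//|s2]; rewrite e12 // s12.
by split=> [|s1]; [rewrite s12|rewrite e12// e23// -s12].
Qed.

Section LiftIt.
Variable B : iproc -> iproc -> Prop.
Hypothesis eB : RelationClasses.Equivalence B.

Let Bxx P : B P P. Proof. by case: eB. Qed.
Let BC P1 P2 : B P1 P2 -> B P2 P1. Proof. by case: eB => _ + _; apply. Qed.
Let BT P2 P1 P3 : B P1 P2 -> B P2 P3 -> B P1 P3.
Proof. by case: eB => _ _; apply. Qed.

Lemma source_Gamma (P : iproc) : sync_free P ->
  source B (Gamma_proc P) = [set u | u.1 = None /\ B P u.2].
Proof.
move=> sP; apply/seteqP; split=> -[[b|] P1] [].
- by move=> P0 [_ _ /pending_Gamma].
- by move=> P0 [_ B0 /Gamma_inj/it_val_inj->].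
- by [].
- by move=> _ BP; exists P.
Qed.

Lemma source_pending (Q : oproc) b (P : iproc) :
  sync_free P -> pending Q b (Gamma P) ->
  source B Q = [set u | u.1 = Some b /\ B P u.2].
Proof.
move=> sP pQ; apply/seteqP; split=> -[[b'|] P1] [].
- by move=> P0 /= [_ B0 /(pending_inj pQ)[-> /Gamma_inj/it_val_inj->]].
- by move=> P0 /= [_ _ QE]; move: pQ; rewrite QE => /pending_Gamma.
- by move=> /= [->] BP; exists P.
- by [].
Qed.

Lemma ot_lift_Gamma (P1 P2 : iproc) : sync_free P1 -> sync_free P2 ->
  B P1 P2 -> ot_lift B (Gamma_proc P1) (Gamma_proc P2).
Proof.
move=> s1 s2 B12; rewrite /ot_lift !source_Gamma//; split.
  apply/seteqP; split=> -[b P] [/= bN BP]; split=> //; apply: BT BP => //.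
  exact: BC.
by move=> /seteqP[/(_ (None, P1))[]].
Qed.

Lemma ot_liftC Q1 Q2 : ot_lift B Q1 Q2 -> ot_lift B Q2 Q1.
Proof. by case: (ot_lift_equiv B) => _ + _; apply. Qed.

(** When the common source is nonempty, the tag of any of its elements tells whether both states are
    translations or both have the same pending action. *)
Lemma ot_lift_source (Q1 Q2 : oproc) : ot_lift B Q1 Q2 ->
  [\/ Q1 = Q2,
      exists P1 P2 : iproc, [/\ sync_free P1, sync_free P2, B P1 P2,
        Q1 = Gamma_proc P1 & Q2 = Gamma_proc P2]
    | exists b (P1 P2 : iproc), [/\ sync_free P1, sync_free P2, B P1 P2,
        pending Q1 b (Gamma P1) & pending Q2 b (Gamma P2)]].
Proof.
move=> [s12 e12]; have [/e12->|/set0P[u su]] := eqVneq (source B Q1) set0.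
  by constructor 1.
have := su; rewrite s12; case: u su => [[b|] P].
  move=> [P1 [/= s1 B1 p1]] [P2 [/= s2 B2 p2]].
  constructor 3; exists b, P1, P2; split=> //; exact: BT B1 (BC B2).
move=> [P1 [/= s1 B1 p1]] [P2 [/= s2 B2 p2]].
constructor 2; exists P1, P2; split=> //; [exact: BT B1 (BC B2)| |].
  exact: ot_val_inj.
exact: ot_val_inj.
Qed.

(** If [Q] has a pending action [b] towards some [Gamma P], its lifted class gathers the pending
    states with action [b] and continuation in [B P], so both rates are integrated-time rates into
    [B P]. Otherwise the class contains no target of a delay, and both rates vanish. *)
Lemma ot_lift_rate (P1 P2 : iproc) (Q : oproc) :
  sync_free P1 -> sync_free P2 ->
  (forall a P, it_rate otimes P1 a (B P) = it_rate otimes P2 a (B P)) ->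
  ot_rate (Gamma_proc P1) (ot_lift B Q) = ot_rate (Gamma_proc P2) (ot_lift B Q).
Proof.
move=> s1 s2 r12.
have [[b [P [sP pQ]]]|noQ] :=
    pselect (exists b (P : iproc), sync_free P /\ pending Q b (Gamma P)).
  have H (Q' : oproc) (P' : iproc) b' :
      sync_free P' -> pending Q' b' (Gamma P') ->
      ot_lift B Q Q' <-> b' = b /\ B P P'.
    move=> sP' pQ'; rewrite /ot_lift (source_pending sP pQ).
    rewrite (source_pending sP' pQ'); split=> [[/seteqP[H _] _]|[-> BP]].
      have [/= [->] BP] := H (Some b, P) (conj erefl (Bxx P)).
      by split=> //; exact: BC.
    split.
      apply/seteqP; split=> -[c P0] [/= cb BP0]; split=> //.
        by apply: BT BP0; exact: BC.
      exact: BT BP BP0.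
    by move=> /seteqP[/(_ (Some b, P))[]].
  by rewrite (ot_rate_Gamma s1 H) (ot_rate_Gamma s2 H).
(* The empty class [set0] expresses the absence of targets; [tau] is an arbitrary label. *)
have H (Q' : oproc) (P' : iproc) b' :
      sync_free P' -> pending Q' b' (Gamma P') ->
    ot_lift B Q Q' <-> b' = tau /\ set0 P'.
  move=> sP' pQ'; split=> [[+ _]|[]//].
  rewrite (source_pending sP' pQ') => /seteqP[_ /(_ (Some b', P'))[]//].
  by move=> P [sP _ pQ]; case: noQ; exists b', P.
by rewrite (ot_rate_Gamma s1 H) (ot_rate_Gamma s2 H) !it_rate_set0.
Qed.

End LiftIt.

(** Eagerness settles the pending states: they enable an action, so the delays still offered by
    their parallel operands are not compared, and the action leads to related translations. *)
Lemma ot_lift_bisimulation B :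
  it_bisimulation otimes B -> ot_bisimulation (ot_lift B).
Proof.
move=> [eB rB]; split=> [|Q1 Q2]; first exact: ot_lift_equiv.
have act (Q1' Q2' : oproc) : ot_lift B Q1' Q2' -> forall a (Q' : oproc),
    ot_astep Q1' a Q' ->
    exists2 Q'' : oproc, ot_astep Q2' a Q'' & ot_lift B Q' Q''.
  move=> /(ot_lift_source eB)[->|[P1 [P2 [_ _ _ -> _]]]
    |[b [P1 [P2 [s1 s2 B12 p1 p2]]]]] a Q'.
  - by exists Q' => //; case: (ot_lift_equiv B).
  - by move=> /Gamma_no_action.
  - move=> /p1[-> Q'E].
    exists (Gamma_proc P2); first exact: pending_action.
    rewrite (_ : Q' = Gamma_proc P1); first exact: ot_lift_Gamma.
    exact: ot_val_inj.
move=> L12; split.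
- exact: act.
- move=> a Q' /(act _ _ (ot_liftC L12))[Q'' s L]; exists Q'' => //.
  exact: ot_liftC.
- move=> n1 n2 D [Q _ <-].
  have [->//|[P1 [P2 [s1 s2 B12 -> ->]]]
    |[b [P1 [P2 [_ _ _ /pending_action/n1]]]]//] := ot_lift_source eB L12.
  by apply: ot_lift_rate => // a P; apply: rB => //; exists P.
Qed.

(** * Restricting an orthogonal-time bisimulation *)

Definition it_restrict (B : oproc -> oproc -> Prop) (P1 P2 : iproc) : Prop :=
  P1 = P2 \/
  [/\ sync_free P1, sync_free P2 & B (Gamma_proc P1) (Gamma_proc P2)].

(** The disjunct [P1 = P2] provides reflexivity at terms that contain synchronization. *)
Lemma it_restrict_equiv B :
  RelationClasses.Equivalence B -> RelationClasses.Equivalence (it_restrict B).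
Proof.
move=> [Bxx BC BT]; split=> [P|P1 P2|P1 P2 P3]; first by left.
  by move=> [->|[s1 s2 B12]]; [left|right; split=> //; exact: BC].
move=> [->//|[s1 s2 B12]] [<-|[_ s3 B23]]; right; split=> //.
exact: BT B12 B23.
Qed.

Lemma it_restrict_bisimulation B :
  ot_bisimulation B -> it_bisimulation otimes (it_restrict B).
Proof.
move=> [eB bB]; split=> [|P1 P2]; first exact: it_restrict_equiv.
case: (it_restrict_equiv eB) => Rxx RC RT.
case: eB => Bxx BC BT.
move=> [->//|[s1 s2 B12]] a _ [P0 _ <-].
pose C := it_restrict B P0.
(* A class of [it_restrict B] pulls back to a union of classes of [B]: those
   of the states whose pending action [a] leads into it. *)
pose K := [set D | range B D /\ exists (Q : oproc) (P : iproc),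
  [/\ D Q, C P, sync_free P & pending Q a (Gamma P)]].
have tK : trivIset K id.
  move=> _ _ [[Q1 _ <-] _] [[Q2 _ <-] _] [Q [/= B1 B2]].
  apply/seteqP; split=> Q'.
    exact: (BT _ _ _ (BT _ _ _ B2 (BC _ _ B1))).
  exact: (BT _ _ _ (BT _ _ _ B1 (BC _ _ B2))).
have KC (Q : oproc) (P : iproc) b : sync_free P -> pending Q b (Gamma P) ->
    (\bigcup_(D in K) D) Q <-> b = a /\ C P.
  move=> sP pQ; split=> [[D [[Q0 _ <-] [Q' [P' [B' CP' sP' pQ']]]] BQ]|[ba CP]].
    (* [Q] must match the action [a] of the equivalent state [Q']; its only action being [b], this
       gives [b = a] and relates [Gamma P'] to [Gamma P]. *)
    have [+ _ _] := bB _ _ (BT _ _ _ (BC _ _ B') BQ).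
    move=> /(_ a (Gamma_proc P') (pending_action pQ'))[Q1 /pQ[-> Q1E] BQ1].
    split=> //; apply: RT CP' _; right; split=> //.
    by rewrite (_ : Gamma_proc P = Q1)//; apply: ot_val_inj.
  by subst b; exists (B Q) => //; split; [exists Q|exists Q, P].
rewrite -(ot_rate_Gamma s1 KC) -(ot_rate_Gamma s2 KC) !ot_rate_bigcup//.
(* Each [D] is a single class of [B], and the rate clause applies because translations enable no
   action. *)
apply: eq_esum => D [rD _]; have [_ _] := bB _ _ B12.
by apply=> //; exact: Gamma_no_action.
Qed.

End Translation.

Theorem theorem2 (R : realType) (VName : Type) (Var : eqType)
    (Relab : set (name VName -> name VName)) (hRelab : relabelings Relab)
    (otimes : {posnum R} -> {posnum R} -> {posnum R})
    (otimesA : associative otimes) (otimesC : commutative otimes)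
    (P1 P2 : it_proc R Var Relab)
    (hP1 : sync_free P1) (hP2 : sync_free P2) :
  it_bisimilar otimes P1 P2 <->
  ot_bisimilar (Gamma_proc P1) (Gamma_proc P2).
Proof.
split=> [[B [bB B12]]|[B [bB B12]]].
  exists (ot_lift B); split; first exact: ot_lift_bisimulation bB.
  by case: bB => eB _; exact: ot_lift_Gamma.
exists (it_restrict B); split; first exact: it_restrict_bisimulation bB.
by right.
Qed.
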